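(* Let $\omega=(q_n)_{n=1}^{\infty}\in(0,1)^{\mathbb N}$, let $E(\omega)$ be the generalized Cantor set for $\omega$, and let $D(\omega):=\mathbb C\setminus E(\omega)$. Then $D(\omega)$ is a uniform domain if and only if $N(\omega,\delta)<\infty$ for some $\delta\in(0,1)$. In fact, if $\delta\in(0,1)$ and $N_0:=N(\omega,\delta)<\infty$, then there exists a constant $c=c(N_0,\delta)$ depending only on $N_0$ and $\delta$ such that $D(\omega)$ is a $c$-uniform domain; and one may take $$c(N_0,\delta):=9\left(\frac{2}{1-\delta}\right)^{N_0+1}\delta^{-1}.$$
   Context: Here $\mathbb N=\{1,2,3,\dots\}$. Generalized Cantor set. For $\omega=(q_n)_{n=1}^\infty\in(0,1)^{\mathbb N}$, put $I=[0,1]$. Remove from $I$ an open interval $J_1$ of length $q_1$ so that $I\setminus J_1$ consists of two closed intervals $I_1^1,I_1^2$ of the same length; let $E_1=I_1^1\cup I_1^2$. Inductively, given $E_k=\bigcup_{i=1}^{2^k}I_k^i$ (a union of $2^k$ disjoint closed intervals of the same length), remove from each $I_k^i$ an open interval of length $|I_k^i|q_{k+1}$ (where $|J|$ denotes the length of an interval $J$) so that the remainder $E_{k+1}$ consists of $2^{k+1}$ closed intervals of the same length (i.e. the removed open interval is centered at the midpoint of $I_k^i$). Then $E(\omega)=\bigcap_{k=1}^\infty E_k\subset[0,1]\subset\mathbb C$. The number $N(\omega,\delta)$. For $\omega=(q_n)_{n=1}^\infty$, $\delta\in(0,1)$ and $i\in\mathbb N$, put $\omega(\delta;i)=\inf\{k\in\mathbb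 N\mid q_{i+k}\ge\delta\}$, with $\omega(\delta;i)=+\infty$ if this set is empty. Then $N(\omega,\delta)=\sup_{i\in\mathbb N}\omega(\delta;i)\in\mathbb N\cup\{+\infty\}$. Uniform domain. For $c\ge1$, a domain $D\subset\mathbb C$ is $c$-uniform if any $a,b\in D$ can be joined by a curve $\gamma$ in $D$ such that for each $z\in\gamma$: (U1) $|\gamma|\le c|a-b|$; and (U2) $\min\{|\gamma_1|,|\gamma_2|\}\le c\,\mathrm{dist}(z,\partial D)$, where $\gamma_1,\gamma_2$ are the connected components of $\gamma\setminus\{z\}$, $|\alpha|$ denotes the length of a curve $\alpha$, and $\mathrm{dist}$ is the Euclidean distance. $D$ is uniform if it is $c$-uniform for some constant $c\ge1$. *)

(* Defs.v *)
From HB Require Import structures.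
From mathcomp Require Import all_boot all_order all_algebra.
From mathcomp Require Import all_classical all_reals all_analysis.
From mathcomp Require Import complex.

Set Implicit Arguments.
Unset Strict Implicit.
Unset Printing Implicit Defensive.

Import Order.TTheory GRing.Theory Num.Theory.
Import numFieldNormedType.Exports.
Import Normc.

Local Open Scope classical_set_scope.
Local Open Scope ring_scope.
Local Open Scope complex_scope.

(* The topology of the plane: the metric topology of the modulus, which the
   library provides for any numFieldType but not for R[i] under that name. *)
HB.instance Definition _ (R : realType) := NormedModule.copy R[i] R[i]^o.

Definition boundary (T : topologicalType) (A : set T) : set T :=
  closure A `\` interior A.

(* normc is the Euclidean modulus with values in R, whereas `|z| lies in R[i].
   The infimum is taken in \bar R, so that the distance to set0 is +oo. *)
Definition dist (R : realType) (z : R[i]) (A : set R[i]) : \bar R :=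
  ereal_inf [set (normc (z - w))%:E | w in A].

Definition polygonal_length (R : realType) (g : R -> R[i]) (s t : R)
    (p : seq R) : R :=
  \sum_(0 <= i < size p)
    normc (g (nth t (s :: p) i.+1) - g (nth t (s :: p) i)).

(* Length of the restriction of g to [s, t]; it is +oo when the restriction is
   not rectifiable and 0 when s = t. *)
Definition curve_length (R : realType) (g : R -> R[i]) (s t : R) : \bar R :=
  ereal_sup [set (polygonal_length g s t p)%:E
            | p in [set p | itv_partition s t p]].

(* Curves are parametrised by [0, 1]. They are simple: this is what makes
   g([0, t[) and g(]t, 1]) the connected components of g([0, 1]) minus g(t).
   The injectivity clause leaves room for the constant curve when a = b. *)
Definition joins (R : realType) (D : set R[i]) (a b : R[i]) (g : R -> R[i]) :=
  [/\ {within `[0, 1]%classic, continuous g},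
      a != b -> {in `[0, 1]%classic &, injective g},
      g 0 = a, g 1 = b &
      forall t : R, 0 <= t <= 1 -> D (g t)].

Definition domain (R : realType) (D : set R[i]) :=
  [/\ D !=set0, open D & connected D].

(* At the endpoints of the curve one of the two components is empty; it then
   has length 0, as curve_length g 0 0 and curve_length g 1 1 do. *)
Definition c_uniform_domain (R : realType) (c : R) (D : set R[i]) :=
  [/\ 1 <= c, domain D &
    forall a b, D a -> D b -> exists g : R -> R[i],
      [/\ joins D a b g,
          (curve_length g 0 1 <= (c * normc (a - b))%:E)%E &
          forall t : R, 0 <= t <= 1 ->
            (Order.min (curve_length g 0 t) (curve_length g t 1)
               <= c%:E * dist (g t) (boundary D))%E]].

Definition uniform_domain (R : realType) (D : set R[i]) :=
  exists c : R, c_uniform_domain c D.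

(* The two closed intervals left after removing from [J.1, J.2] the centered
   open interval of length q * (J.2 - J.1). *)
Definition middle_split (R : realType) (q : R) (J : R * R) : seq (R * R) :=
  let m := (J.1 + J.2) / 2 in
  let h := q * (J.2 - J.1) / 2 in
  [:: (J.1, m - h); (m + h, J.2)].

(* A sequence (q_n) for n >= 1 is a function on nat whose value at 0 is never
   used. *)
Fixpoint cantor_intervals (R : realType) (q : nat -> R) (k : nat) :
    seq (R * R) :=
  if k is k'.+1 then
    flatten [seq middle_split (q k) J | J <- cantor_intervals q k']
  else [:: (0, 1)].

Definition cantor_level (R : realType) (q : nat -> R) (k : nat) : set R :=
  \bigcup_(J in [set` cantor_intervals q k]) `[J.1, J.2]%classic.

Definition cantor_set (R : realType) (q : nat -> R) : set R :=
  \bigcap_(k in [set k | (1 <= k)%N]) cantor_level q k.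

Definition cantor_complement (R : realType) (q : nat -> R) : set R[i] :=
  ~` [set x%:C | x in cantor_set q].

Definition waiting_time (R : realType) (q : nat -> R) (delta : R) (i : nat) :
    \bar R :=
  ereal_inf [set k%:R%:E | k in [set k | (1 <= k)%N /\ delta <= q (i + k)%N]].

Definition max_waiting_time (R : realType) (q : nat -> R) (delta : R) :
    \bar R :=
  ereal_sup [set waiting_time q delta i | i in [set i | (1 <= i)%N]].

Definition cantor_uniformity_constant (R : realType) (N0 : nat) (delta : R) :
    R :=
  9 * (2 / (1 - delta)) ^+ (N0 + 1) * delta^-1.

(* Main.v *)
Require Import Defs.
From mathcomp Require Import all_boot all_order all_algebra.
From mathcomp Require Import all_classical all_reals all_analysis.
From mathcomp Require Import complex ring lra.

(** For sufficiency, two points in the same closed half plane are joined by a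
    tent over the segment between them. Two points on opposite sides of the real
    line at distance l are joined through a gap of E: if k is the first level
    whose intervals have length at most l, some level j in [k, k + N0] has
    q_j >= delta, and next to the level j interval containing a point of E there
    is a gap of length at least delta ((1 - delta) / 2)^N0 l. The path rises
    above that gap, drops through it and rises to the other point.

    For necessity, suppose that q_{i+1}, ..., q_{i+M} are small and that I is an
    interval of level i. A curve joining the points at height |I| / (8c) above
    and below the midpoint of I has length at most |I| / 4, so it crosses the real
    line in a gap contained in I, which is too narrow for the cigar condition. *)

Set Implicit Arguments.
Unset Strict Implicit.
Unset Printing Implicit Defensive.

Import Order.TTheory GRing.Theory Num.Theory.
Import numFieldNormedType.Exports.
Import Normc.

Local Open Scope classical_set_scope.
Local Open Scope ring_scope.
Local Open Scope complex_scope.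

Local Notation Re := complex.Re.
Local Notation Im := complex.Im.

(** * The plane and curve length *)

Lemma normcE (R : realType) (z : R[i]) : (normc z)%:C = `|z|.
Proof. by []. Qed.

Lemma normc_ge0 (R : realType) (z : R[i]) : 0 <= normc z.
Proof. by case: z => x y; exact: sqrtr_ge0. Qed.

Lemma normcBC (R : realType) (x y : R[i]) : normc (x - y) = normc (y - x).
Proof. by apply: complexI; rewrite !normcE distrC. Qed.

Lemma normc_gt0 (R : realType) (z : R[i]) : (0 < normc z) = (z != 0).
Proof. by rewrite -(ltcR 0) normcE normr_gt0. Qed.

Lemma ler_Re_normc (R : realType) (z : R[i]) : `|Re z| <= normc z.
Proof.
by case: z => x y /=; rewrite -sqrtr_sqr ler_wsqrtr// lerDl sqr_ge0.
Qed.

Lemma ler_Im_normc (R : realType) (z : R[i]) : `|Im z| <= normc z.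
Proof.
by case: z => x y /=; rewrite -sqrtr_sqr ler_wsqrtr// lerDr sqr_ge0.
Qed.

Lemma ler_normc_ReIm (R : realType) (z : R[i]) :
  normc z <= `|Re z| + `|Im z|.
Proof.
case: z => x y /=.
rewrite -[leRHS]ger0_norm ?addr_ge0// -sqrtr_sqr ler_wsqrtr//.
by rewrite sqrrD !real_normK ?num_real// addrAC lerDl mulrn_wge0// mulr_ge0.
Qed.

Lemma normc_conjc (R : realType) (z : R[i]) : normc (conjc z) = normc z.
Proof. by case: z => x y /=; rewrite sqrrN. Qed.

Lemma ReB (R : realType) (x y : R[i]) : Re (x - y) = Re x - Re y.
Proof. by case: x; case: y. Qed.

Lemma ImB (R : realType) (x y : R[i]) : Im (x - y) = Im x - Im y.
Proof. by case: x; case: y. Qed.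

Lemma posc_real (R : realType) (e : R[i]) : 0 < e -> e = (Re e)%:C /\ 0 < Re e.
Proof. by case: e => x y; rewrite ltcE /= => /andP[/eqP -> ->]. Qed.

(** Balls of [R[i]] have radii in [R[i]]; a positive radius is real by [posc_real], so
    neighbourhoods can be handled through the real-valued [normc]. *)
Lemma nbhs_normcP (R : realType) (z : R[i]) (A : set R[i]) :
  nbhs z A <-> exists2 e : R, 0 < e & forall w, normc (z - w) < e -> A w.
Proof.
split.
- move=> /nbhs_ballP[e /= e0 eA]; have [eE Re0] := posc_real e0.
  exists (Re e) => // w zw; apply: eA.
  by rewrite -ball_normE /= eE -normcE ltcR.
- move=> [e e0 eA]; apply/nbhs_ballP; exists e%:C => /=; first by rewrite ltcR.
  by move=> w; rewrite -ball_normE /= -normcE ltcR; exact: eA.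
Qed.

Lemma Re_continuous (R : realType) : continuous (@Re R : R[i] -> R).
Proof.
move=> z A /nbhs_ballP[e /= e0 eA]; apply/nbhs_normcP; exists e => // w zw.
by apply: eA; rewrite /ball /= -ReB (le_lt_trans (ler_Re_normc _)).
Qed.

Lemma Im_continuous (R : realType) : continuous (@Im R : R[i] -> R).
Proof.
move=> z A /nbhs_ballP[e /= e0 eA]; apply/nbhs_normcP; exists e => // w zw.
by apply: eA; rewrite /ball /= -ImB (le_lt_trans (ler_Im_normc _)).
Qed.

Lemma lipschitz_curve_continuous (R : realType) (g : R -> R[i]) (K s t : R) :
  (forall u v, s <= u -> u <= v -> v <= t -> normc (g u - g v) <= K * (v - u)) ->
  {within `[s, t]%classic, continuous g}.
Proof.
move=> gK; apply/subspace_continuousP => x /=; rewrite in_itv /= => /andP[sx xt].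
apply/cvgrPdist_lt => e e0; have [-> Re0] := posc_real e0.
(* [K] may be zero, as it is for constant curves; [|K| + 1] can be divided by. *)
have K1 : 0 < `|K| + 1 by rewrite ltr_wpDl.
rewrite /within /=; apply/nbhs_ballP; exists (Re e / (`|K| + 1)) => /=.
  by rewrite divr_gt0.
move=> y; rewrite -ball_normE /= in_itv /= ltr_pdivlMr // => xy /andP[sy yt].
rewrite -normcE ltcR; apply: le_lt_trans xy.
have Kle : K <= `|K| + 1 by rewrite ler_wpDr// ler_norm.
have [xley|/ltW ylex] := leP x y.
- apply: le_trans (gK _ _ sx xley yt) _; rewrite ler0_norm ?subr_le0// opprB.
  by rewrite mulrC ler_wpM2l// subr_ge0.
- rewrite normcBC; apply: le_trans (gK _ _ sy ylex xt) _.
  by rewrite ger0_norm ?subr_ge0// mulrC ler_wpM2l// subr_ge0.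
Qed.

Lemma polygonal_length_cons (R : realType) (g : R -> R[i]) (s t x : R)
    (p : seq R) :
  polygonal_length g s t (x :: p) =
  normc (g x - g s) + polygonal_length g x t p.
Proof. by rewrite /polygonal_length /= big_nat_recl. Qed.

(** Each polygonal sum is at most [K] times a telescoping sum of parameter steps; the induction
    moves the left end [s] to the first partition point. *)
Lemma curve_length_lipschitz (R : realType) (g : R -> R[i]) (K s t : R) :
  (forall u v, s <= u -> u <= v -> v <= t -> normc (g u - g v) <= K * (v - u)) ->
  (curve_length g s t <= (K * (t - s))%:E)%E.
Proof.
move=> gK; apply: ge_ereal_sup => _ [p /= pst <-]; rewrite lee_fin.
elim: p s gK pst => [|x p IH] s gK.
  move=> /itv_partition_nil ->.
  by rewrite /polygonal_length big_geq// subrr mulr0.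
move=> sxp; have xp := itv_partition_cons sxp.
have sx : s <= x by case: sxp => /= /andP[/ltW].
have xt := itv_partition_le xp.
rewrite polygonal_length_cons normcBC.
have -> : K * (t - s) = K * (x - s) + K * (t - x) by ring.
apply: lerD; first exact: gK.
by apply: IH => // u v xu uv vt; apply: gK => //; exact: le_trans xu.
Qed.

Lemma curve_length_ge_chord (R : realType) (g : R -> R[i]) (s t : R) :
  s < t -> ((normc (g t - g s))%:E <= curve_length g s t)%E.
Proof.
move=> st; apply: ereal_sup_ubound; exists [:: t].
  exact: itv_partition1.
by rewrite polygonal_length_cons /polygonal_length big_geq// addr0.
Qed.

Lemma curve_length_ge_chords (R : realType) (g : R -> R[i]) (s u t : R) :
  s < u -> u < t ->
  ((normc (g u - g s) + normc (g t - g u))%:E <= curve_length g s t)%E.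
Proof.
move=> su ut; apply: ereal_sup_ubound; exists [:: u; t].
  by rewrite /= /itv_partition /= su ut eqxx.
by rewrite !polygonal_length_cons /polygonal_length big_geq// addr0.
Qed.

(** * Uniform curves *)

(* By the Lipschitz bound, [K * t] and [K * (1 - t)] dominate the lengths of the
   two arcs of [g] at [g t]. *)
Definition lipschitz_joined (R : realType) (E : set R) (c : R) (a b : R[i]) :=
  exists (g : R -> R[i]) (K : R),
    [/\ [/\ 0 < K, K <= c * normc (a - b), g 0 = a & g 1 = b],
        forall u v, 0 <= u -> u <= v -> v <= 1 -> normc (g u - g v) <= K * (v - u),
        forall u v, 0 <= u -> u < v -> v <= 1 -> g u <> g v &
        forall t e, 0 <= t -> t <= 1 -> E e ->
          Num.min (K * t) (K * (1 - t)) <= c * normc (g t - e%:C)].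

(** Reflection in the real line is an isometry that fixes [E] pointwise, so only one sign
    configuration of each kind has to be treated. *)
Lemma lipschitz_joined_conjc (R : realType) (E : set R) (c : R) (a b : R[i]) :
  lipschitz_joined E c (conjc a) (conjc b) -> lipschitz_joined E c a b.
Proof.
have subJ (x y : R[i]) : conjc x - conjc y = conjc (x - y).
  by case: x => x1 x2; case: y => y1 y2; rewrite -[RHS]/((x1 - y1) +i* (- (x2 - y2))) opprD.
have JK (x : R[i]) : conjc (conjc x) = x by case: x => x y /=; rewrite opprK.
move=> [g [K [[K0 Kc g0 g1] gK ginj gE]]].
exists (fun t => conjc (g t)), K; split.
- by rewrite -normc_conjc -subJ g0 g1 !JK.
- by move=> u v u0 uv v1; rewrite subJ normc_conjc gK.
- by move=> u v u0 uv v1 /(congr1 conjc); rewrite !JK; exact: ginj.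
- move=> t e t0 t1 Ee; rewrite -normc_conjc -subJ JK.
  have -> : conjc e%:C = e%:C :> R[i] by rewrite /= oppr0.
  exact: gE.
Qed.

Lemma lipschitz_joined_domain (R : realType) (E : set R) (c : R) (a b : R[i]) :
  let D := ~` [set x%:C | x in E] in
  D a -> D b -> open D -> 0 < c -> lipschitz_joined E c a b ->
  exists g : R -> R[i],
    [/\ joins D a b g,
        (curve_length g 0 1 <= (c * normc (a - b))%:E)%E &
        forall t : R, 0 <= t <= 1 ->
          (Order.min (curve_length g 0 t) (curve_length g t 1)
             <= c%:E * dist (g t) (boundary D))%E].
Proof.
move=> D Da Db oD c0 [g [K [[K0 Kc g0 g1] gK ginj gE]]]; exists g; split.
- split => //.
  + exact: lipschitz_curve_continuous gK.
  + move=> _ u v; rewrite !inE /= !in_itv /= => /andP[u0 u1] /andP[v0 v1] guv.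
    have [uv|vu|//] := ltgtP u v.
      by have := ginj _ _ u0 uv v1.
    by have := ginj _ _ v0 vu u1; rewrite guv.
  (* At a point of [E] the right-hand side of [gE] vanishes, which forces [t] to be 0 or 1; but [a]
     and [b] lie in [D]. *)
  + move=> t /andP[t0 t1] [e Ee et]; have := gE t e t0 t1 Ee.
    rewrite et subrr normc0 mulr0 ge_min !pmulr_rle0// subr_le0 => /orP[t0'|t1'].
      by apply: Da; exists e; rewrite // et -g0; congr g; apply/le_anti/andP.
    by apply: Db; exists e; rewrite // et -g1; congr g; apply/le_anti/andP.
- apply: le_trans (curve_length_lipschitz gK) _.
  by rewrite lee_fin subr0 mulr1.
- move=> t /andP[t0 t1].
  have gKl u v : 0 <= u -> u <= v -> v <= t -> normc (g u - g v) <= K * (v - u).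
    by move=> u0 uv vt; apply: gK => //; exact: le_trans t1.
  have gKr u v : t <= u -> u <= v -> v <= 1 -> normc (g u - g v) <= K * (v - u).
    by move=> tu uv vt; apply: gK => //; exact: le_trans tu.
  rewrite muleC -lee_pdivrMr//; apply: le_ereal_inf_tmp => _ [w [_ wD] <-].
  (* The open set [D] contains none of its boundary points, so [w] comes from [E]. *)
  have [e Ee ew] : [set x%:C | x in E] w.
    by move/interior_id: oD => oD; apply: contra_notP wD; rewrite oD.
  rewrite lee_pdivrMr// -EFinM -ew mulrC.
  apply: le_trans (_ : (Num.min (K * t) (K * (1 - t)))%:E <= _)%E; last first.
    by rewrite lee_fin; exact: gE.
  rewrite EFin_min; apply: le_min2.
    by have := curve_length_lipschitz gKl; rewrite subr0.
  exact: curve_length_lipschitz gKr.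
Qed.

(* A tent of height [l] over the segment [a, b]: away from its ends it stays at a
   height comparable to the arc length. Over a vertical segment it would run
   over itself, but there the segment itself has that property. *)
Lemma lipschitz_joined_upper (R : realType) (E : set R) (c : R) (a b : R[i]) :
  4 <= c -> a != b -> 0 <= Im a -> 0 <= Im b -> lipschitz_joined E c a b.
Proof.
move=> c4 ab; set l := normc (a - b).
have l0 : 0 < l by rewrite normc_gt0 subr_eq0.
have Rel : `|Re a - Re b| <= l by rewrite -ReB ler_Re_normc.
have Iml : `|Im a - Im b| <= l by rewrite -ImB ler_Im_normc.
move: Rel Iml; have lE : l <= `|Re a - Re b| + `|Im a - Im b|.
  by rewrite -ReB -ImB ler_normc_ReIm.
case: a b @l ab l0 lE => [a1 a2] [b1 b2]; set a := _ +i* _; set b := _ +i* _.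
move=> l ab l0 /= lE Rel Iml a0 b0.
have height (x y e : R) : `|y| <= normc ((x +i* y) - e%:C).
  by apply: le_trans (ler_Im_normc _); rewrite ImB /= subr0.
have [ab1|ab1] := eqVneq a1 b1.
- have l2 : l <= `|a2 - b2| by move: lE; rewrite ab1 subrr normr0 add0r.
  exists (fun t => a1 +i* (a2 + (b2 - a2) * t)), l; split.
  + split => //.
    * by rewrite ler_peMl ?normc_ge0//; lra.
    * by rewrite mulr0 addr0.
    * by rewrite mulr1 addrC subrK ab1.
  + move=> u v u0 uv v1; apply: le_trans (ler_normc_ReIm _) _.
    rewrite ReB ImB /= subrr normr0 add0r.
    have -> : a2 + (b2 - a2) * u - (a2 + (b2 - a2) * v) = (a2 - b2) * (v - u) by ring.
    by rewrite normrM (@ger0_norm _ (v - u)) ?subr_ge0// ler_wpM2r ?subr_ge0.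
  + move=> u v u0 uv v1 [] /addrI /mulfI uv'.
    have : b2 - a2 != 0.
      by rewrite subr_eq0; apply: contra ab => /eqP ba2; rewrite /a /b ba2 ab1.
    by move=> /uv' uvE; rewrite uvE ltxx in uv.
  + move=> t e t0 t1 Ee; set h := Num.min _ _.
    apply: le_trans (_ : h <= `|a2 + (b2 - a2) * t|) _; last first.
      apply: le_trans (height a1 _ e) _.
      by rewrite ler_peMl ?normc_ge0//; lra.
    (* Both ends have nonnegative height, so the height of a point is at least its distance along
       the segment to the lower end. *)
    apply: le_trans (ler_norm _); rewrite /h ge_min.
    move: l2; have [ba|ab2] := leP b2 a2.
      rewrite ger0_norm ?subr_ge0// => l2; apply/orP; right; nra.
    by rewrite ltr0_norm ?subr_lt0// opprB => l2; apply/orP; left; nra.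
(* The horizontal motion, the vertical motion and the tent, whose slopes are [2 * l] and [- 2 * l],
   contribute [l], [l] and [2 * l] to the Lipschitz constant. The real part alone gives
   injectivity. *)
- exists (fun t => (a1 + (b1 - a1) * t) +i*
     (a2 + (b2 - a2) * t + l * (1 - `|2 * t - 1|))), (4 * l); split.
  + split.
    * by rewrite mulr_gt0.
    * by rewrite ler_wpM2r ?normc_ge0.
    * by rewrite !mulr0 !addr0 sub0r normrN1 subrr mulr0 addr0.
    * rewrite !mulr1 (_ : 2 - 1 = 1); last by ring.
      by rewrite normr1 subrr mulr0 addr0 !(addrC _ (_ - _)) !subrK.
  + move=> u v u0 uv v1; apply: le_trans (ler_normc_ReIm _) _.
    rewrite ReB ImB /=.
    have dabs : `| `|2 * v - 1| - `|2 * u - 1| | <= 2 * (v - u).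
      apply: le_trans (ler_dist_dist _ _) _.
      by rewrite ger0_norm; lra.
    have -> : a1 + (b1 - a1) * u - (a1 + (b1 - a1) * v) = (a1 - b1) * (v - u) by ring.
    set w := (X in _ + `|X|); have -> : w = (a2 - b2) * (v - u) +
        l * (`|2 * v - 1| - `|2 * u - 1|) by rewrite /w; ring.
    apply: le_trans (lerD (lexx _) (ler_normD _ _)) _.
    rewrite !normrM (@ger0_norm _ (v - u)) ?subr_ge0// (ger0_norm (ltW l0)).
    have := ler_wpM2l (ltW l0) dabs.
    have vu : 0 <= v - u by rewrite subr_ge0.
    have := ler_wpM2r vu Rel; have := ler_wpM2r vu Iml; lra.
  + move=> u v u0 uv v1 [] /addrI /mulfI uv' _.
    have /uv' uvE : b1 - a1 != 0 by rewrite subr_eq0 eq_sym.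
    by rewrite uvE ltxx in uv.
  + move=> t e t0 t1 Ee; set h := Num.min _ _; set y := _ + l * _.
    apply: le_trans (_ : h <= 4 * `|y|) _; last first.
      apply: ler_pM => //; exact: height.
    apply: le_trans (_ : h <= 4 * y) _; last by rewrite ler_wpM2l// ler_norm.
    (* The interpolation of [a2] and [b2] is nonnegative, and the tent equals [2 * l] times the
       smaller of [t] and [1 - t], so four times it exceeds what is required. *)
    have t1' : 0 <= 1 - t by rewrite subr_ge0.
    have := mulr_ge0 a0 t1'; have := mulr_ge0 b0 t0.
    have := mulr_ge0 (ltW l0) t0; have := mulr_ge0 (ltW l0) t1'.
    rewrite /h /y ge_min => *; apply/orP.
    by have [_|_] := ger0P (2 * t - 1); [right|left]; lra.
Qed.

(* The fractions of the three sides of the path of [lipschitz_joined_across]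
   covered at time [t]; they add up to [3 * t]. *)
Lemma clamped_thirds_mono (R : realType) (u v : R) :
  let p1 (t : R) := Num.min 1 (3 * t) in
  let p3 (t : R) := Num.max 0 (3 * t - 2) in
  let p2 t := 3 * t - p1 t - p3 t in
  u <= v -> [/\ p1 u <= p1 v, p2 u <= p2 v & p3 u <= p3 v].
Proof.
move=> /= uv; rewrite /Num.min /Num.max.
case: (ltP 1 (3 * u)) => u1; case: (ltP 0 (3 * u - 2)) => u2;
  case: (ltP 1 (3 * v)) => v1; case: (ltP 0 (3 * v - 2)) => v2; split; lra.
Qed.

(* The path climbs from [a] to a point above [y], drops vertically through [y],
   and climbs to [b]; each side has length at most [3 * l]. When [y] is the
   abscissa of an endpoint the path would run over itself. *)
Lemma lipschitz_joined_across (R : realType) (E : set R) (c d y : R) (a b : R[i]) :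
  let l := normc (a - b) in
  36 <= c -> 9 / 2 * l <= c * d -> 0 < Im a -> Im b < 0 ->
  y != Re a -> y != Re b ->
  `|y - Re a| <= 21 / 8 * l -> `|y - Re b| <= 21 / 8 * l ->
  (forall e, E e -> d <= `|y - e|) -> lipschitz_joined E c a b.
Proof.
move=> l c36 cd.
have : `|Im a - Im b| <= l by rewrite -ImB ler_Im_normc.
have : 0 <= l by exact: normc_ge0.
case: a b @l cd => [a1 a2] [b1 b2]; set a := _ +i* _; set b := _ +i* _.
move=> l cd l0' /= Iml a0 b0 ya yb xa xb yE.
have l0 : 0 < l.
  rewrite normc_gt0; apply/eqP => /(congr1 (@Im R))/=; lra.
have norml : normc (a - b) = l by [].
move: (l) norml l0 cd Iml xa xb => {l0'} {}l norml l0 cd Iml xa xb.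
(* [h] is the height gained on each outer side. Since 21/8 + 1/4 is below 3, an outer side is
   shorter than [3 * l], and the drop is at most [l + 2 * h]; this gives the constant [9 * l] for
   three sides run at triple speed. *)
have [h hE] : exists h, h = l / 4 by exists (l / 4).
pose p1 (t : R) := Num.min 1 (3 * t); pose p3 (t : R) := Num.max 0 (3 * t - 2).
pose p2 t := 3 * t - p1 t - p3 t.
pose x t := a1 + p1 t * (y - a1) + p3 t * (b1 - y).
pose z t := a2 + p1 t * h + p2 t * (b2 - a2 - 2 * h) + p3 t * h.
have p_mono u v : u <= v -> [/\ p1 u <= p1 v, p2 u <= p2 v & p3 u <= p3 v].
  exact: clamped_thirds_mono.
have left_piece t : 3 * t <= 1 -> x t = a1 + 3 * t * (y - a1) /\ z t = a2 + 3 * t * h.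
  move=> t1; rewrite /x /z /p2 /p1 /p3 min_r// max_l; last by lra.
  by split; ring.
have mid_piece t : 1 <= 3 * t -> 3 * t <= 2 ->
    x t = y /\ z t = a2 + h + (3 * t - 1) * (b2 - a2 - 2 * h).
  move=> t1 t2; rewrite /x /z /p2 /p1 /p3 min_l// max_l; last by lra.
  by split; ring.
have right_piece t : 2 <= 3 * t ->
    x t = b1 + 3 * (1 - t) * (y - b1) /\ z t = b2 - 3 * (1 - t) * h.
  move=> t2; rewrite /x /z /p2 /p1 /p3 min_l ?max_r; [|lra..].
  by split; ring.
have h0 : 0 < h by rewrite hE; lra.
have height (r s e : R) : `|s| <= normc ((r +i* s) - e%:C).
  by apply: le_trans (ler_Im_normc _); rewrite ImB /= subr0.
have width (r s e : R) : `|r - e| <= normc ((r +i* s) - e%:C).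
  by apply: le_trans (ler_Re_normc _); rewrite ReB /=.
exists (fun t => x t +i* z t), (9 * l); split.
- split.
  + by lra.
  + by rewrite norml ler_pM2r//; lra.
  + have [|-> ->] := left_piece 0; first by lra.
    by rewrite mulr0 !mul0r !addr0.
  + have [|-> ->] := right_piece 1; first by lra.
    by rewrite subrr mulr0 !mul0r !addr0 subr0.
- move=> u v u0 uv v1; have [q1 q2 q3] := p_mono u v uv.
  apply: le_trans (ler_normc_ReIm _) _; rewrite ReB ImB /=.
  have -> : x u - x v = (p1 v - p1 u) * (a1 - y) + (p3 v - p3 u) * (y - b1).
    by rewrite /x; ring.
  have -> : z u - z v = - (p1 v - p1 u) * h + (p2 v - p2 u) * (a2 - b2 + 2 * h)
       - (p3 v - p3 u) * h by rewrite /z; ring.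
  have q2E : p2 v - p2 u = 3 * (v - u) - (p1 v - p1 u) - (p3 v - p3 u).
    by rewrite /p2; ring.
  rewrite -subr_ge0 in q1; rewrite -subr_ge0 q2E in q2; rewrite -subr_ge0 in q3.
  rewrite q2E.
  move: (p1 v - p1 u) (p3 v - p3 u) q1 q2 q3 => r1 r3 r10 r20 r30.
  (* The increments [r1], [r2], [r3] are nonnegative with sum [3 * (v - u)]; each is multiplied by
     the length of its side, at most [3 * l] in the sum norm. *)
  set r2 := 3 * (v - u) - r1 - r3 in r20 *.
  apply: le_trans (lerD (ler_normD _ _) (le_trans (ler_normB _ _) _)) _.
    exact: (lerD (ler_normD _ _) (lexx _)).
  rewrite !normrM normrN !(@ger0_norm _ r1, @ger0_norm _ r2, @ger0_norm _ r3)//.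
  rewrite (ger0_norm (ltW h0)) (distrC a1).
  have m0 : 0 <= a2 - b2 + 2 * h by lra.
  rewrite (ger0_norm m0).
  have := ler_norm (a2 - b2); have := ler_wpM2l r10 xa.
  have := ler_wpM2l r30 xb => k1 k2 k3.
  have k4 : a2 - b2 + 2 * h <= 3 / 2 * l by rewrite hE; lra.
  have := ler_wpM2l r20 k4.
  have := mulr_ge0 r10 (ltW l0); have := mulr_ge0 r20 (ltW l0).
  have := mulr_ge0 r30 (ltW l0); rewrite hE /r2; lra.
(* Within one side the height is strictly monotone. The drop differs from the outer sides in
   abscissa, by [ya] and [yb], and the outer sides lie strictly on opposite sides of the real
   line. *)
- move=> u v u0 uv v1 [xE zE].
  have off (r w : R) : y != w -> r != 0 -> y + r * (w - y) != y.
    move=> yw r0; rewrite -subr_eq0 addrAC subrr add0r mulf_neq0//.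
    by rewrite subr_eq0 eq_sym.
  have [u1|u1] := leP 1 (3 * u); last first.
    have [xu zu] := left_piece u (ltW u1).
    have xuy : x u != y.
      have -> : x u = y + (1 - 3 * u) * (a1 - y) by rewrite xu; ring.
      by rewrite off//; apply/eqP; lra.
    have [v2|v2] := leP (3 * v) 1.
      by have [_ zv] := left_piece v v2; nra.
    have [v3|v3] := leP (3 * v) 2.
      by have [xv _] := mid_piece v (ltW v2) v3; rewrite xE xv eqxx in xuy.
    by have [_ zv] := right_piece v (ltW v3); nra.
  have [u2|u2] := leP (3 * u) 2; last first.
    have [_ zu] := right_piece u (ltW u2).
    have v2 : 2 <= 3 * v by lra.
    by have [_ zv] := right_piece v v2; nra.
  have [xu zu] := mid_piece u u1 u2.
  have [v2|v2] := leP (3 * v) 2.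
    have v1' : 1 <= 3 * v by lra.
    by have [_ zv] := mid_piece v v1' v2; nra.
  have [xv _] := right_piece v (ltW v2).
  have r0 : 1 - 3 * (1 - v) != 0 by apply/eqP; lra.
  have := off _ _ yb r0; rewrite (_ : _ + _ = x v); last by rewrite xv; ring.
  by rewrite -xE xu eqxx.
- move=> t e t0 t1 Ee; rewrite ge_min; apply/orP.
  have c0 : 0 <= c by lra.
  have [t2|t2] := leP (3 * t) 1.
    left; have [_ zt] := left_piece t t2.
    apply: le_trans (ler_wpM2l c0 (height _ _ _)).
    apply: le_trans (ler_wpM2l c0 (ler_norm _)); rewrite zt.
    have := mulr_ge0 t0 (ltW h0) => th0.
    apply: le_trans (_ : 36 * (a2 + 3 * t * h) <= _); last by rewrite ler_wpM2r//; lra.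
    by rewrite hE in th0 *; lra.
  have [t3|t3] := leP (3 * t) 2; last first.
    right; have [_ zt] := right_piece t (ltW t3).
    apply: le_trans (ler_wpM2l c0 (height _ _ _)).
    rewrite -normrN; apply: le_trans (ler_wpM2l c0 (ler_norm _)); rewrite zt.
    have t1' : 0 <= 1 - t by lra.
    have := mulr_ge0 t1' (ltW h0) => th0.
    apply: le_trans (_ : 36 * - (b2 - 3 * (1 - t) * h) <= _); last by rewrite ler_wpM2r//; lra.
    by rewrite hE in th0 *; lra.
  (* On the drop the distance to [E] is at least [d], and [9 / 2 * l] is half of [9 * l], which
     bounds the shorter arc. *)
  have [xt _] := mid_piece t (ltW t2) t3; rewrite xt.
  have cw : 9 / 2 * l <= c * normc ((y +i* z t) - e%:C).
    by apply: le_trans cd _; rewrite ler_wpM2l// (le_trans (yE _ Ee)).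
  have [t4|t4] := leP t (1 / 2); [left|right]; apply: le_trans cw; nra.
Qed.

(** * The Cantor set *)

(** The common length of the intervals of level [k]; see [cantor_interval_length]. *)
Definition cantor_length (R : realType) (q : nat -> R) (k : nat) : R :=
  \prod_(0 <= j < k) ((1 - q j.+1) / 2).

Section cantor_structure.
Variables (R : realType) (q : nat -> R).
Hypothesis q01 : forall n : nat, (1 <= n)%N -> 0 < q n < 1.

Local Notation L := (cantor_length q).
Local Notation ivals := (cantor_intervals q).
Local Notation E := (cantor_set q).

Lemma cantor_length0 : L 0 = 1.
Proof. by rewrite /cantor_length big_geq. Qed.

Lemma cantor_lengthS k : L k.+1 = L k * ((1 - q k.+1) / 2).
Proof. by rewrite /cantor_length big_nat_recr. Qed.

Lemma cantor_length_gt0 k : 0 < L k.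
Proof.
elim: k => [|k IH]; first by rewrite cantor_length0.
have /andP[_ q1] := q01 (ltn0Sn k).
by rewrite cantor_lengthS mulr_gt0// divr_gt0// subr_gt0.
Qed.

Lemma cantor_length_halve k m : L (k + m) <= 2^-1 ^+ m * L k.
Proof.
elim: m => [|m IH]; first by rewrite addn0 mul1r.
have /andP[q0 _] := q01 (ltn0Sn (k + m)).
rewrite addnS cantor_lengthS exprS -mulrA mulrC.
have L0 := cantor_length_gt0 (k + m).
apply: ler_pM => //; last by lra.
have /andP[_ q1] := q01 (ltn0Sn (k + m)).
by rewrite divr_ge0// subr_ge0 ltW.
exact: ltW.
Qed.

Lemma cantor_length_le k m : (k <= m)%N -> L m <= L k.
Proof.
move=> /subnKC <-; apply: le_trans (cantor_length_halve _ _) _.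
have L0 := cantor_length_gt0 k.
by rewrite ger_pMl// exprn_ile1// ?invr_ge0//; lra.
Qed.

Lemma cantor_interval_split k P : P.2 = P.1 + L k ->
  middle_split (q k.+1) P = [:: (P.1, P.1 + L k.+1); (P.2 - L k.+1, P.2)].
Proof.
move=> PL; rewrite /middle_split cantor_lengthS.
by congr [:: (_, _); (_, _)]; rewrite PL; field.
Qed.

Lemma cantor_interval_length k J : J \in ivals k -> J.2 = J.1 + L k.
Proof.
elim: k J => [|k IH] J; first by rewrite inE => /eqP -> /=; rewrite cantor_length0 add0r.
move=> /flatten_mapP[P /IH PL]; rewrite (cantor_interval_split PL) !inE.
by case/orP => /eqP -> //=; rewrite subrK.
Qed.

Lemma cantor_interval_child k J : J \in ivals k.+1 ->
  exists2 P, P \in ivals k &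
    J = (P.1, P.1 + L k.+1) \/ J = (P.2 - L k.+1, P.2).
Proof.
move=> /flatten_mapP[P Pk]; have PL := cantor_interval_length Pk.
rewrite (cantor_interval_split PL) !inE => JP; exists P => //.
by case/orP: JP => /eqP; [left|right].
Qed.

Lemma cantor_interval_left k P : P \in ivals k -> (P.1, P.1 + L k.+1) \in ivals k.+1.
Proof.
move=> Pk; apply/flatten_mapP; exists P => //.
by rewrite (cantor_interval_split (cantor_interval_length Pk)) !inE eqxx.
Qed.

Lemma cantor_interval_right k P : P \in ivals k -> (P.2 - L k.+1, P.2) \in ivals k.+1.
Proof.
move=> Pk; apply/flatten_mapP; exists P => //.
by rewrite (cantor_interval_split (cantor_interval_length Pk)) !inE eqxx orbT.
Qed.

Lemma cantor_gap_width k P : P \in ivals k ->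
  P.2 - L k.+1 = P.1 + L k.+1 + q k.+1 * L k.
Proof. by move=> /cantor_interval_length ->; rewrite cantor_lengthS; field. Qed.

(** The parents share [x] and agree by induction; the two children of one parent are separated by a
    gap of positive length. *)
Lemma cantor_interval_inj k J J' x : J \in ivals k -> J' \in ivals k ->
  J.1 <= x <= J.2 -> J'.1 <= x <= J'.2 -> J = J'.
Proof.
elim: k J J' => [|k IH] J J'; first by rewrite !inE => /eqP -> /eqP ->.
move=> /cantor_interval_child[P Pk JP] /cantor_interval_child[P' P'k J'P'] xJ xJ'.
have L0 := cantor_length_gt0 k.+1; have L0' := cantor_length_gt0 k.
have /andP[q0 _] := q01 (ltn0Sn k); have qL := mulr_gt0 q0 L0'.
have PL := cantor_gap_width Pk; have P'L := cantor_gap_width P'k.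
have PP' : P = P'.
  by apply: IH => //; [case: JP xJ => -> /=|case: J'P' xJ' => -> /=]; lra.
by subst P'; case: JP xJ => -> /=; case: J'P' xJ' => -> //= ? ?; exfalso; lra.
Qed.

Lemma cantor_level_antitone m n : (m <= n)%N ->
  cantor_level q n `<=` cantor_level q m.
Proof.
move=> /subnKC <-; elim: (n - m)%N => [|k IH]; first by rewrite addn0.
rewrite addnS => x [J /= /cantor_interval_child[P Pk JP] xJ]; apply: IH.
exists P => //; move: xJ; rewrite /= !in_itv /=.
have L0 := cantor_length_gt0 (m + k).+1; have L0' := cantor_length_gt0 (m + k).
have /andP[q0 _] := q01 (ltn0Sn (m + k)); have qL := mulr_gt0 q0 L0'.
by have := cantor_gap_width Pk; case: JP => -> /=; lra.
Qed.

Lemma cantor_set_interval x k : E x ->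
  exists2 J, J \in ivals k & J.1 <= x <= J.2.
Proof.
move=> Ex; have [J Jk xJ] : cantor_level q k x.
  by apply: (@cantor_level_antitone k k.+1) => //; exact: Ex.
by exists J => //; move: xJ; rewrite /= in_itv.
Qed.

Lemma cantor_set_sub01 x : E x -> 0 <= x <= 1.
Proof. by move=> /(cantor_set_interval 0)[J]; rewrite inE => /eqP ->. Qed.

Lemma cantor_setP x k :
  (forall m, (k <= m)%N -> cantor_level q m x) -> E x.
Proof.
move=> Hx n _; apply: (@cantor_level_antitone n (n + k)); first exact: leq_addr.
by apply: Hx; exact: leq_addl.
Qed.

(** An endpoint survives every later removal, as the endpoint of an outermost descendant. *)
Lemma cantor_set_endpoints k J : J \in ivals k -> E J.1 /\ E J.2.
Proof.
move=> Jk; split; apply: (@cantor_setP _ k) => n /subnKC <-.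
- have [P Pn PJ] : exists2 P, P \in ivals (k + (n - k)) & P.1 = J.1.
    elim: (n - k)%N => [|m [P Pm PJ]]; first by exists J; rewrite // addn0.
    by rewrite addnS; eexists; first exact: cantor_interval_left Pm.
  exists P; rewrite //= in_itv /= PJ lexx /= -PJ.
  by rewrite (cantor_interval_length Pn) lerDl ltW ?cantor_length_gt0.
- have [P Pn PJ] : exists2 P, P \in ivals (k + (n - k)) & P.2 = J.2.
    elim: (n - k)%N => [|m [P Pm PJ]]; first by exists J; rewrite // addn0.
    by rewrite addnS; eexists; first exact: cantor_interval_right Pm.
  exists P; rewrite //= in_itv /= -PJ lexx andbT.
  by rewrite (cantor_interval_length Pn) lerDl ltW ?cantor_length_gt0.
Qed.

Lemma cantor_set_neq0 : E !=set0.
Proof.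
have [] := @cantor_set_endpoints 0 (0, 1); first by rewrite inE.
by exists 0.
Qed.

Lemma closed_cantor_set : closed E.
Proof.
apply: closed_bigI => k _; apply: closed_bigcup; first exact: finite_seq.
by move=> J _; exact: interval_closed.
Qed.

(** A point of [E] strictly inside the gap would lie in [P] and in a child of some [P']; by
    disjointness [P' = P], whose children avoid the gap. *)
Lemma cantor_gap_free k P e : P \in ivals k -> E e ->
  e <= P.1 + L k.+1 \/ P.2 - L k.+1 <= e.
Proof.
move=> Pk /(cantor_set_interval k.+1)[J /cantor_interval_child[P' P'k JP'] eJ].
have [eP|Pe] := leP e (P.1 + L k.+1); first by left.
have [eP'|P'e] := leP (P.2 - L k.+1) e; first by right.
have L0 := cantor_length_gt0 k.+1; have L0' := cantor_length_gt0 k.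
have /andP[q0 _] := q01 (ltn0Sn k); have qL := mulr_gt0 q0 L0'.
have PL := cantor_gap_width Pk; have P'L := cantor_gap_width P'k.
have PP' : P = P'.
  apply: (@cantor_interval_inj k _ _ e) => //; first by lra.
  by case: JP' eJ => -> /=; lra.
by subst P'; case: JP' eJ => -> /=; lra.
Qed.

(** At the first level that omits [z], this point falls into the gap of an interval of the preceding
    level [j]. The witness [e] is the left end of that gap. *)
Lemma cantor_gap_around i J z : J \in ivals i -> J.1 <= z <= J.2 -> ~ E z ->
  exists2 j, (i <= j)%N & exists2 e, E e & `|z - e| <= q j.+1 * L j.
Proof.
move=> Ji zJ zE.
have zi : cantor_level q i z by exists J; rewrite //= in_itv.
have : exists k, `[< ~ cantor_level q k z >].
  apply: contra_notP zE => zE; apply: (@cantor_setP _ 0) => m _.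
  by apply: contra_notP zE => zE; exists m; apply/asboolP.
case/ex_minnP => k /asboolP zk kmin.
have ik : (i < k)%N.
  by rewrite ltnNge; apply: contra_notN zk => ki; exact: cantor_level_antitone zi.
case: k ik zk kmin => // j ij zj kmin; exists j => //.
have [P /= Pj] : cantor_level q j z.
  apply: contrapT => zj'; have : (j < j)%N by apply: kmin; apply/asboolP.
  by rewrite ltnn.
rewrite in_itv /= => zP; exists (P.1 + L j.+1).
  by have [] := cantor_set_endpoints (cantor_interval_left Pj).
have PL := cantor_gap_width Pj.
have z1 : P.1 + L j.+1 < z.
  rewrite ltNge; apply: contra_notN zj => zl.
  exists (P.1, P.1 + L j.+1); first exact: cantor_interval_left.
  by rewrite /= in_itv /= zl andbT; lra.
have z2 : z < P.2 - L j.+1.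
  rewrite ltNge; apply: contra_notN zj => zl.
  exists (P.2 - L j.+1, P.2); first exact: cantor_interval_right.
  by rewrite /= in_itv /= zl /=; lra.
by rewrite ger0_norm; lra.
Qed.

End cantor_structure.

(** * Gaps and curves at every scale *)

(** Half of the relative length [delta * ((1 - delta) / 2) ^+ N] guaranteed for a gap: a point at
    this depth in the gap is at least as far from both ends. *)
Definition gap_ratio (R : realType) (N : nat) (delta : R) : R :=
  delta / 2 * ((1 - delta) / 2) ^+ N.

Section cantor_gaps.
Variables (R : realType) (q : nat -> R) (N : nat) (delta : R).
Hypothesis q01 : forall n : nat, (1 <= n)%N -> 0 < q n < 1.
Hypothesis delta01 : 0 < delta < 1.

Hypothesis waitN : forall i, (1 <= i)%N ->
  exists2 k, (1 <= k <= N)%N & delta <= q (i + k)%N.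

Local Notation L := (cantor_length q).
Local Notation ivals := (cantor_intervals q).
Local Notation E := (cantor_set q).
Local Notation kappa := (gap_ratio N delta).
Local Notation r := ((1 - delta) / 2).

Lemma gap_ratio_gt0 : 0 < kappa.
Proof.
have /andP[d0 d1] := delta01.
by rewrite mulr_gt0 ?exprn_gt0// ?divr_gt0// subr_gt0.
Qed.

Lemma gap_ratio_le : kappa <= 1 / 4.
Proof.
have /andP[d0 d1] := delta01.
(* The hypothesis [waitN] forces [1 <= N], so one factor [r] is available. *)
have [k /andP[k1 kN] _] := waitN (leqnn 1).
have rN : r ^+ N <= r.
  rewrite -[leRHS]expr1 ler_wiXn2l ?(leq_trans k1)//; lra.
have r0 : 0 <= r ^+ N by rewrite exprn_ge0//; lra.
rewrite /gap_ratio; nra.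
Qed.

Lemma cantor_gap_near x l : E x -> 0 < l ->
  exists2 y, `|y - x| <= (1 + kappa) * l &
    forall e, E e -> kappa * l <= `|y - e|.
Proof.
have /andP[d0 d1] := delta01.
move=> Ex l0; have kl0 := mulr_gt0 gap_ratio_gt0 l0.
have [l1|l1] := leP 1 l.
  (* At scales beyond the diameter of [E], the half line to the left of 0 serves as the gap. *)
  exists (- (kappa * l)).
    have /andP[x0 x1] := cantor_set_sub01 q01 Ex.
    by rewrite ler0_norm; lra.
  move=> e /(cantor_set_sub01 q01)/andP[e0 e1].
  by rewrite ler0_norm; lra.
have : exists k, L k <= l.
  (* With [n] this integer, [l^-1 < n.+1 <= 2 ^ n]. *)
  exists (Num.truncn l^-1); have := cantor_length_halve q01 0 (Num.truncn l^-1).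
  rewrite add0n cantor_length0 mulr1 => /le_trans; apply.
  have li : l^-1 < (Num.truncn l^-1).+1%:R by rewrite truncnS_gt.
  rewrite exprVn -[leRHS]invrK lef_pV2 ?posrE ?exprn_gt0 ?invr_gt0//.
  apply: le_trans (ltW li) _; rewrite -natrX ler_nat; exact: ltn_expl.
case/ex_minnP => -[|k] Lk kmin.
  by move: Lk; rewrite cantor_length0; lra.
have Lk' : l < L k.
  by rewrite ltNge; apply/negP => /kmin; rewrite ltnn.
have : exists i, delta <= q (k.+1 + i)%N.
  by have [i _ iq] := waitN (ltn0Sn k); exists i.
(* The search begins at [i = 0], that is at [q k.+1], while [waitN] speaks of later indices only;
   the first hit is therefore still at most [N]. *)
case/ex_minnP => i qi imin.
have iN : (i <= N)%N.
  have [i' /andP[_ i'N] i'q] := waitN (ltn0Sn k).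
  exact: leq_trans (imin _ i'q) i'N.
have r0 : 0 < r by lra.
(* Before the first hit every ratio is below [delta], so each level keeps more than the fraction [r]
   of the length. *)
have Li : r ^+ i * l <= L (k + i).
  have : (i <= i)%N by [].
  elim: {-2}i => [|m IH] mi; first by rewrite mul1r addn0 ltW.
  rewrite addnS cantor_lengthS exprS -mulrA mulrC.
  have qm : q (k + m).+1 < delta.
    by rewrite ltNge; apply/negP => /(imin m); rewrite leqNgt mi.
  apply: ler_pM; [|lra| |lra].
    by rewrite mulr_ge0 ?exprn_ge0// ltW.
  by apply: IH; exact: ltnW.
have rNi : r ^+ N <= r ^+ i by rewrite ler_wiXn2l//; lra.
have Lki := cantor_length_gt0 q01 (k + i).
(* The component of level [k + i + 1] containing [x] is no longer than [l], and
   it is adjacent to a gap of length at least [2 * kappa * l]. *)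
have [J Jk xJ] := cantor_set_interval q01 (k + i).+1 Ex.
have [P Pk JP] := cantor_interval_child Jk.
have gapP : 2 * (kappa * l) <= q (k + i).+1 * L (k + i).
  have -> : 2 * (kappa * l) = delta * (r ^+ N * l) by rewrite /gap_ratio; field.
  apply: ler_pM => //; first by lra.
    by rewrite mulr_ge0 ?exprn_ge0// ltW.
  by apply: le_trans Li; rewrite ler_wpM2r// ltW.
have L' : L (k + i).+1 <= l.
  by apply: le_trans Lk; apply: cantor_length_le => //; rewrite ltnS leq_addr.
have PL := cantor_gap_width Pk.
case: JP xJ => -> /= /andP[xJ1 xJ2].
- exists (P.1 + L (k + i).+1 + kappa * l).
    by rewrite ger0_norm; lra.
  move=> e Ee; have [eP|Pe] := cantor_gap_free q01 Pk Ee.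
    by rewrite ger0_norm; lra.
  by rewrite ler0_norm; lra.
- exists (P.2 - L (k + i).+1 - kappa * l).
    by rewrite ler0_norm; lra.
  move=> e Ee; have [eP|Pe] := cantor_gap_free q01 Pk Ee.
    by rewrite ger0_norm; lra.
  by rewrite ler0_norm; lra.
Qed.

(** Either [p] itself is far from [E], or [cantor_gap_near] applies at a point of [E] close to [p].
    A final shift avoids the abscissae [s] and [t] at the cost of half the distance. The bound 13/8
    is [(1 + 2 * kappa) + kappa / 2] at [kappa = 1 / 4]. *)
Lemma cantor_crossing (p l s t : R) : 0 < l ->
  exists y, [/\ y != s, y != t, `|y - p| <= 13 / 8 * l &
    forall e, E e -> kappa / 2 * l <= `|y - e|].
Proof.
move=> l0; have kl0 := mulr_gt0 gap_ratio_gt0 l0.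
have kl4 : kappa * l <= 1 / 4 * l by rewrite ler_wpM2r ?gap_ratio_le// ltW.
have [y0 y0p y0E] : exists2 y, `|y - p| <= (1 + 2 * kappa) * l &
    forall e, E e -> kappa * l <= `|y - e|.
  have [pE|] := pselect (forall e, E e -> kappa * l <= `|p - e|).
    by exists p; rewrite // subrr normr0; lra.
  move=> /existsNP[x /not_implyP[Ex /negP]]; rewrite -ltNge => px.
  have [y yx yE] := cantor_gap_near Ex l0; exists y => //.
  have -> : y - p = (y - x) - (p - x) by ring.
  by apply: le_trans (ler_normB _ _) _; lra.
(* Of the three points at distance 0, 1/4 and 1/2 of [kappa * l] to the right of [y0], one differs
   from both [s] and [t]. *)
have [y [yy0 ys yt]] : exists y, [/\ `|y - y0| <= kappa * l / 2, y != s & y != t].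
  have shift (m : R) : 0 <= m <= 1 -> `|y0 + m * (kappa * l / 2) - y0| <= kappa * l / 2.
    move=> m01; rewrite addrAC subrr add0r ger0_norm; nra.
  have shift0 : `|y0 - y0| <= kappa * l / 2 by rewrite subrr normr0; lra.
  have s1 := shift (1 / 2) ltac:(lra); have s2 := shift 1 ltac:(lra).
  have [y0s|y0s] := eqVneq y0 s; have [y0t|y0t] := eqVneq y0 t.
  - by exists (y0 + 1 * (kappa * l / 2)); split => //; apply/eqP; lra.
  - have [y1t|y1t] := eqVneq (y0 + 1 / 2 * (kappa * l / 2)) t.
      by exists (y0 + 1 * (kappa * l / 2)); split => //; apply/eqP; lra.
    by exists (y0 + 1 / 2 * (kappa * l / 2)); split => //; apply/eqP; lra.
  - have [y1s|y1s] := eqVneq (y0 + 1 / 2 * (kappa * l / 2)) s.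
      by exists (y0 + 1 * (kappa * l / 2)); split => //; apply/eqP; lra.
    by exists (y0 + 1 / 2 * (kappa * l / 2)); split => //; apply/eqP; lra.
  - by exists y0.
exists y; split => //.
- have -> : y - p = (y - y0) + (y0 - p) by ring.
  by apply: le_trans (ler_normD _ _) _; lra.
- move=> e Ee; have := y0E e Ee.
  have -> : y0 - e = (y - e) - (y - y0) by ring.
  by move=> /le_trans/(_ (ler_normB _ _)); lra.
Qed.

(** The powers of [2 / (1 - delta)] and of [r] cancel up to one factor, and the product is
    [9 / (1 - delta)]. This is what the drop in [lipschitz_joined_across] needs for
    [d = kappa / 2 * l]. *)
Lemma gap_ratio_constant :
  9 <= cantor_uniformity_constant N delta * kappa.
Proof.
have /andP[d0 d1] := delta01.
have r0 : 0 < 1 - delta by lra.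
rewrite /cantor_uniformity_constant /gap_ratio addn1 exprS.
have rA : (2 / (1 - delta)) ^+ N * r ^+ N = 1.
  rewrite -exprMn (_ : _ * _ = 1) ?expr1n//; field.
  by rewrite gt_eqF.
have -> : 9 * (2 / (1 - delta) * (2 / (1 - delta)) ^+ N) / delta *
    (delta / 2 * r ^+ N) = 9 / (1 - delta) * ((2 / (1 - delta)) ^+ N * r ^+ N).
  by field; apply/andP; split; rewrite gt_eqF//; lra.
by rewrite rA mulr1 ler_pdivlMr//; lra.
Qed.

Lemma cantor_uniformity_constant_ge :
  36 <= cantor_uniformity_constant N delta.
Proof.
have := gap_ratio_constant; have := gap_ratio_gt0; have := gap_ratio_le.
move: (gap_ratio _ _) (cantor_uniformity_constant _ _) => k c; nra.
Qed.

Lemma lipschitz_joined_cantor (a b : R[i]) : a != b ->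
  lipschitz_joined E (cantor_uniformity_constant N delta) a b.
Proof.
move=> ab_neq.
set c := cantor_uniformity_constant _ _.
have c36 : 36 <= c := cantor_uniformity_constant_ge.
have c4 : 4 <= c by lra.
have ck : 9 <= c * kappa := gap_ratio_constant.
have across u v : 0 < Im u -> Im v < 0 -> lipschitz_joined E c u v.
  move=> u0 v0; have l0 : 0 < normc (u - v).
    by rewrite normc_gt0 subr_eq0; apply/eqP => uv; move: v0; rewrite -uv; lra.
  have [y [yu yv yp yE]] := cantor_crossing (Re u) (Re u) (Re v) l0.
  apply: (@lipschitz_joined_across _ _ _ (kappa / 2 * normc (u - v)) y) => //.
  - have := ler_wpM2r (ltW l0) ck; lra.
  - by apply: le_trans yp _; rewrite ler_wpM2r//; lra.
  (* Hence 21/8, as 13/8 + 1. *)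
  - have -> : y - Re v = (y - Re u) + (Re u - Re v) by ring.
    apply: le_trans (ler_normD _ _) _; rewrite -ReB.
    by have := ler_Re_normc (u - v); lra.
have ImJ (u : R[i]) : Im (conjc u) = - Im u by case: u.
have upper u v : u != v -> 0 <= Im u -> 0 <= Im v -> lipschitz_joined E c u v.
  by move=> uv u0 v0; exact: lipschitz_joined_upper.
have conj_neq : conjc a != conjc b.
  apply: contra ab_neq => /eqP; case: a => a1 a2; case: b => b1 b2 [-> /oppr_inj ->].
  by [].
have [a0|a0] := leP 0 (Im a); have [b0|b0] := leP 0 (Im b).
- exact: upper.
(* A point on the real line belongs to both closed half planes, and is put with the other point. *)
- have [a0'|a0'] := leP (Im a) 0; last exact: across.
  by apply: lipschitz_joined_conjc; apply: upper; rewrite // ImJ; lra.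
- have [b0'|b0'] := leP (Im b) 0.
    by apply: lipschitz_joined_conjc; apply: upper; rewrite // ImJ; lra.
  by apply: lipschitz_joined_conjc; apply: across; rewrite ImJ; lra.
- by apply: lipschitz_joined_conjc; apply: upper; rewrite // ImJ; lra.
Qed.

End cantor_gaps.

(** * Waiting times and uniformity *)

Section waiting_times.
Variables (R : realType) (q : nat -> R) (delta : R).

Lemma waiting_time_ltS i n : (waiting_time q delta i < n.+1%:R%:E)%E ->
  exists2 k, (1 <= k <= n)%N & delta <= q (i + k)%N.
Proof.
move=> /ereal_inf_lt[_ [k [k1 kq] <-]]; rewrite lte_fin ltr_nat ltnS => kn.
by exists k; rewrite ?k1.
Qed.

Lemma max_waiting_time_le n :
  (forall i, (1 <= i)%N -> exists2 k, (1 <= k <= n)%N & delta <= q (i + k)%N) ->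
  (max_waiting_time q delta <= n%:R%:E)%E.
Proof.
move=> H; apply: ge_ereal_sup => _ [i /= i1 <-].
have [k /andP[k1 kn] kq] := H i i1.
apply: ge_ereal_inf; exists k%:R%:E; first by exists k.
by rewrite lee_fin ler_nat.
Qed.

Lemma max_waiting_time_ltS n : (max_waiting_time q delta < n.+1%:R%:E)%E ->
  forall i, (1 <= i)%N -> exists2 k, (1 <= k <= n)%N & delta <= q (i + k)%N.
Proof.
move=> H i i1; apply: waiting_time_ltS; apply: le_lt_trans H.
by apply: ereal_sup_ubound; exists i.
Qed.

(** The value is the least [n] with supremum below [n.+1]: the strict bound yields a witness at most
    [n] for every [i], and a supremum below [n] would contradict minimality. *)
Lemma max_waiting_time_attained : (max_waiting_time q delta < +oo)%E ->
  exists2 n, max_waiting_time q delta = n%:R%:E &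
    forall i, (1 <= i)%N -> exists2 k, (1 <= k <= n)%N & delta <= q (i + k)%N.
Proof.
move=> Wfin.
have : exists n, `[< (max_waiting_time q delta < n.+1%:R%:E)%E >].
  move: Wfin; case: (max_waiting_time q delta) => [w _|//|_].
    by exists (Num.truncn w); apply/asboolP; rewrite lte_fin truncnS_gt.
  by exists 0%N; apply/asboolP; rewrite ltNyr.
case/ex_minnP => n /asboolP /max_waiting_time_ltS nW nmin; exists n => //.
apply/le_anti; rewrite max_waiting_time_le//= leNgt; apply/negP.
case: n nW nmin => [|n] nW nmin Wn.
  by have [k] := nW 1%N isT; case: k.
have : (n < n)%N by apply: nmin; apply/asboolP.
by rewrite ltnn.
Qed.

End waiting_times.

(** * Topology of the complement of a closed subset of the real line *)

Section cantor_complement_topology.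
Variables (R : realType) (E : set R).
Hypothesis Eclosed : closed E.

Local Notation D := (~` [set x%:C | x in E]).

Lemma open_complement_real : open D.
Proof.
rewrite openC.
have -> : [set x%:C | x in E] = @Im R @^-1` [set 0] `&` @Re R @^-1` E.
  apply/seteqP; split=> [_ [x Ex <-]//|[x y] [/= -> Ex]].
  by exists x.
apply: closedI.
- apply: ((continuous_closedP (@Im R)).1 (@Im_continuous R)).
  exact/accessible_closed_set1/hausdorff_accessible/Rhausdorff.
- exact: ((continuous_closedP (@Re R)).1 (@Re_continuous R)).
Qed.

Lemma off_real_complement (z : R[i]) : Im z != 0 -> D z.
Proof. by move=> z0 [x _ xz]; move: z0; rewrite -xz eqxx. Qed.

(** Points straight above [x] are off the real line and tend to [x]. *)
Lemma boundary_complement_real x : E x -> boundary D x%:C.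
Proof.
move=> Ex; split; last by move=> /interior_subset; apply; exists x.
move=> B /nbhs_normcP[e e0 eB]; exists (x +i* (e / 2)); split.
  by apply: off_real_complement; rewrite /= gt_eqF// divr_gt0.
apply: eB; apply: le_lt_trans (ler_normc_ReIm _) _.
rewrite ReB ImB /= subrr normr0 add0r sub0r normrN gtr0_norm ?divr_gt0//.
by lra.
Qed.

End cantor_complement_topology.

(** The case of equal endpoints, which [lipschitz_joined] excludes by asking for [0 < K] and
    [K <= c * normc (a - b)]. *)
Lemma constant_joins (R : realType) (D : set R[i]) (c : R) (a : R[i]) :
  D a -> 0 <= c ->
  exists g : R -> R[i],
    [/\ joins D a a g,
        (curve_length g 0 1 <= (c * normc (a - a))%:E)%E &
        forall t : R, 0 <= t <= 1 ->
          (Order.min (curve_length g 0 t) (curve_length g t 1)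
             <= c%:E * dist (g t) (boundary D))%E].
Proof.
move=> Da c0; have lip s t (u v : R) : s <= u -> u <= v -> v <= t ->
    normc ((fun=> a) u - (fun=> a) v) <= 0 * (v - u).
  by move=> *; rewrite subrr normc0 mul0r.
have len s t : (curve_length (fun=> a) s t <= 0)%E.
  by have := curve_length_lipschitz (lip s t); rewrite mul0r.
exists (fun=> a); split.
- split=> //; last by rewrite eqxx.
  exact: lipschitz_curve_continuous (lip 0 1).
- by rewrite subrr normc0 mulr0.
- move=> t _; rewrite ge_min; apply/orP; left; apply: le_trans (len _ _) _.
  rewrite mule_ge0//; apply: le_ereal_inf_tmp => _ [w _ <-].
  by rewrite lee_fin normc_ge0.
Qed.

Lemma connected_of_joins (R : realType) (D : set R[i]) (a : R[i]) : D a ->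
  (forall b, D b -> exists g, joins D a b g) -> connected D.
Proof.
move=> Da joinD.
pose P (S : set R[i]) := [/\ S a, S `<=` D & connected S].
have -> : D = \bigcup_(S in P) id S.
  apply/seteqP; split=> [b Db|b [S [_ SD _]]]; last exact: SD.
  have [g [gc _ g0 g1 gD]] := joinD b Db.
  have cS : connected (g @` `[0, 1]).
    by apply: connected_continuous_connected gc; exact: segment_connected.
  exists (g @` `[0, 1]); last by exists 1; rewrite //= in_itv /= ler01 lexx.
  split => //; first by exists 0; rewrite //= in_itv /= ler01 lexx.
  by move=> _ [t /= + <-]; rewrite in_itv; exact: gD.
apply: bigcup_connected; last by move=> S [].
by exists a => S [].
Qed.

(** * Sufficiency and necessity of a finite waiting time *)

Lemma cantor_complement_c_uniform (R : realType) (q : nat -> R) (N : nat)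
    (delta : R) :
  (forall n : nat, (1 <= n)%N -> 0 < q n < 1) -> 0 < delta < 1 ->
  (forall i, (1 <= i)%N ->
    exists2 k, (1 <= k <= N)%N & delta <= q (i + k)%N) ->
  c_uniform_domain (cantor_uniformity_constant N delta) (cantor_complement q).
Proof.
move=> q01 delta01 waitN; set c := cantor_uniformity_constant _ _.
have c36 : 36 <= c by exact: cantor_uniformity_constant_ge waitN.
have oD : open (cantor_complement q).
  by apply: open_complement_real; exact: closed_cantor_set.
have curves a b : cantor_complement q a -> cantor_complement q b ->
    exists g : R -> R[i],
      [/\ joins (cantor_complement q) a b g,
          (curve_length g 0 1 <= (c * normc (a - b))%:E)%E &
          forall t : R, 0 <= t <= 1 ->
            (Order.min (curve_length g 0 t) (curve_length g t 1)
               <= c%:E * dist (g t) (boundary (cantor_complement q)))%E].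
  move=> Da Db; have [<-|ab] := eqVneq a b.
    by apply: constant_joins => //; lra.
  apply: lipschitz_joined_domain => //; first by lra.
  exact: lipschitz_joined_cantor.
have Di : cantor_complement q 'i%C.
  by apply: off_real_complement; rewrite /= oner_neq0.
split => //; first by lra.
split => //; first by exists 'i%C.
apply: (connected_of_joins Di) => b /(curves _ _ Di)[g [gj _ _]].
by exists g.
Qed.

Lemma max_waiting_time_of_uniform (R : realType) (q : nat -> R) (c : R) :
  (forall n : nat, (1 <= n)%N -> 0 < q n < 1) ->
  c_uniform_domain c (cantor_complement q) ->
  exists delta : R, 0 < delta < 1 /\ (max_waiting_time q delta < +oo)%E.
Proof.
move=> q01 [c1 _ curves].
have c0 : 0 < c by lra.
(* The cigar condition will put the crossing point at distance at least [l / (8 * c ^+ 2)] from [E];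
   a ratio below this [delta] leaves no room for that. *)
pose delta : R := (9 * c ^+ 2)^-1.
have cc1 : 1 <= c ^+ 2 by rewrite exprn_ege1.
have cc0 : 0 < c ^+ 2 by lra.
have delta0 : 0 < delta by rewrite invr_gt0 mulr_gt0.
have delta8 : delta < (8 * c ^+ 2)^-1.
  by rewrite ltf_pV2 ?posrE ?mulr_gt0// ltr_pM2r//; lra.
exists delta; split.
  by rewrite delta0 invf_lt1 ?mulr_gt0//; lra.
(* After [M] further levels the intervals themselves have length at most [l / (8 * c ^+ 2)], so
   deeper gaps are too narrow whatever their ratios. *)
pose M := Num.truncn (8 * c ^+ 2).
have M8 : 2^-1 ^+ M <= (8 * c ^+ 2)^-1.
  rewrite exprVn lef_pV2 ?posrE ?exprn_gt0 ?mulr_gt0//.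
  apply: le_trans (ltW (truncnS_gt _)) _; rewrite -natrX ler_nat; exact: ltn_expl.
apply: (@le_lt_trans _ _ M%:R%:E); last by rewrite ltry.
apply: max_waiting_time_le => i i1; apply: contrapT => qsmall.
have {}qsmall k : (1 <= k <= M)%N -> q (i + k)%N < delta.
  by move=> kM; rewrite ltNge; apply/negP => kq; apply: qsmall; exists k.
have [x0 Ex0] := cantor_set_neq0 q01.
have [J Ji _] := cantor_set_interval q01 i Ex0.
set l := cantor_length q i; have l0 : 0 < l := cantor_length_gt0 q01 i.
have JL := cantor_interval_length Ji; rewrite -/l in JL.
pose h := l / (8 * c); have h0 : 0 < h by rewrite divr_gt0// mulr_gt0.
pose a := (J.1 + l / 2) +i* h; pose b := (J.1 + l / 2) +i* (- h).
have Da : cantor_complement q a by apply: off_real_complement; rewrite /= gt_eqF.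
have Db : cantor_complement q b.
  by apply: off_real_complement; rewrite /= oppr_eq0 gt_eqF.
have [g [[gc _ g0 g1 gD] glen gdist]] := curves a b Da Db.
have [t t01 gt0] : exists2 t, t \in `[0, 1] & (@Im R \o g) t = 0.
  apply: IVT => //.
    move=> x; exact: (continuous_comp (gc x) (@Im_continuous R (g x))).
  rewrite /= g0 g1 /= ge_min le_max; apply/andP; split; apply/orP; [right|left]; lra.
move: t01; rewrite in_itv /= => /andP[t0 t1].
(* The ends of the curve are off the real line, so the crossing is interior and both arcs have
   chords. *)
have {}t0 : 0 < t.
  rewrite lt_neqAle t0 andbT; apply/eqP => t0'.
  by move: gt0; rewrite /= -t0' g0 /=; lra.
have {}t1 : t < 1.
  rewrite lt_neqAle t1 andbT; apply/eqP => t1'.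
  by move: gt0; rewrite /= t1' g1 /=; lra.
have Dz : cantor_complement q (g t) by apply: gD; rewrite !ltW.
have dist_z := gdist t; have {dist_z} dist_z := dist_z ltac:(by rewrite !ltW).
have ab : normc (a - b) <= 2 * h.
  apply: le_trans (ler_normc_ReIm _) _; rewrite ReB ImB /= subrr normr0 add0r opprK.
  by rewrite gtr0_norm; lra.
have chords := le_trans (curve_length_ge_chords g t0 t1) glen.
have chord0 := curve_length_ge_chord g t0; have chord1 := curve_length_ge_chord g t1.
have zt : g t = (Re (g t))%:C by move: gt0 => /=; case: (g t) => u v /= ->.
move: (Re (g t)) zt => z zt; rewrite {}zt {gD} in Dz dist_z chords chord0 chord1.
have zE : ~ cantor_set q z by move=> Ez; apply: Dz; exists z.
rewrite lee_fin in chords.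
rewrite g0 g1 in chords; rewrite g0 in chord0; rewrite g1 in chord1.
have za : `|z - (J.1 + l / 2)| <= normc (z%:C - a).
  by apply: le_trans (ler_Re_normc _); rewrite ReB.
have za' : h <= normc (z%:C - a).
  by apply: le_trans (ler_Im_normc _); rewrite ImB /= sub0r normrN gtr0_norm.
have zb' : h <= normc (b - z%:C).
  by apply: le_trans (ler_Im_normc _); rewrite ImB /= subr0 normrN gtr0_norm.
have cch : c * normc (a - b) <= l / 4.
  apply: le_trans (ler_wpM2l (ltW c0) ab) _; rewrite /h.
  by rewrite le_eqVlt; apply/orP; left; apply/eqP; field; rewrite gt_eqF.
(* The two chords at [z] add up to at most [l / 4], so [z] is within [l / 4] of the midpoint of
   [J]. *)
have zJ : J.1 <= z <= J.2.
  move: za; rewrite ler_norml => /andP[za1 za2].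
  have := normc_ge0 (b - z%:C); lra.
have [j ij [e Ee ze]] := cantor_gap_around q01 Ji zJ zE.
have zel : `|z - e| < (8 * c ^+ 2)^-1 * l.
  apply: le_lt_trans ze _.
  have Lj := cantor_length_gt0 q01 j; have Lji := cantor_length_le q01 ij.
  have /andP[qj0 qj1] := q01 _ (ltn0Sn j).
  (* At the first [M] levels below [i] the ratio is small; beyond them the length is. *)
  have [jM|Mj] := ltnP j (i + M).
    apply: (@lt_le_trans _ _ ((8 * c ^+ 2)^-1 * cantor_length q j)).
      rewrite ltr_pM2r//; apply: lt_trans delta8.
      have := qsmall (j.+1 - i)%N; rewrite subnKC ?(leq_trans ij)//; apply.
      by rewrite subn_gt0 ltnS ij leq_subLR.
    by rewrite ler_wpM2l// invr_ge0 mulr_ge0// ltW.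
  apply: (@lt_le_trans _ _ (cantor_length q j)); first by rewrite gtr_pMl.
  apply: le_trans (cantor_length_le q01 Mj) _.
  by apply: le_trans (cantor_length_halve q01 i M) _; rewrite ler_wpM2r// ltW.
have hE : h = c * ((8 * c ^+ 2)^-1 * l).
  by rewrite /h; field; rewrite gt_eqF.
(* Each arc ends at height [h] or [- h], so it has length at least [h]; the cigar condition then
   contradicts [zel]. *)
have : h <= c * `|z - e|.
  rewrite -lee_fin; apply: (@le_trans _ _ (c%:E * dist z%:C (boundary (cantor_complement q)))%E).
    apply: le_trans dist_z; rewrite le_min; apply/andP; split.
      by apply: le_trans chord0; rewrite lee_fin.
    by apply: le_trans chord1; rewrite lee_fin.
  rewrite EFinM lee_pmul2l ?lte_fin//.
  apply: ge_ereal_inf; exists (normc (z%:C - e%:C))%:E.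
    exists e%:C => //; exact: boundary_complement_real.
  rewrite lee_fin; apply: le_trans (ler_normc_ReIm _) _.
  by rewrite ReB ImB /= subrr normr0 addr0.
by rewrite hE ler_pM2l// leNgt zel.
Qed.

Theorem theorem1 (R : realType) (q : nat -> R)
    (hq : forall n : nat, (1 <= n)%N -> 0 < q n < 1) :
  (uniform_domain (cantor_complement q) <->
     exists delta : R,
       0 < delta < 1 /\ (max_waiting_time q delta < +oo)%E) /\
  (forall delta : R, 0 < delta < 1 -> (max_waiting_time q delta < +oo)%E ->
     exists2 N0 : nat, max_waiting_time q delta = (N0%:R)%:E &
       c_uniform_domain (cantor_uniformity_constant N0 delta)
         (cantor_complement q)).
Proof.
have sufficient : forall delta : R, 0 < delta < 1 ->
    (max_waiting_time q delta < +oo)%E ->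
    exists2 N0 : nat, max_waiting_time q delta = (N0%:R)%:E &
      c_uniform_domain (cantor_uniformity_constant N0 delta)
        (cantor_complement q).
  move=> delta delta01 /max_waiting_time_attained[N ? waitN]; exists N => //.
  exact: cantor_complement_c_uniform.
split=> //; split=> [[c]|[delta [delta01 /(sufficient _ delta01)[N _]]]].
  exact: max_waiting_time_of_uniform.
by exists (cantor_uniformity_constant N delta).
Qed.
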